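(* The map $(\mathbb{R},d_e)\ni t\mapsto\sinh(t)\in(H^1(\mathbb{R}),d_h)$ is an isometry.
   Context: $d_e$ is the usual metric on $\mathbb{R}$. $H^1(\mathbb{R})=\mathbb{R}$ with the metric $d_h(x,y)=\cosh^{-1}\bigl(\sqrt{1+x^2}\sqrt{1+y^2}-xy\bigr)$, where $\cosh^{-1}(t)=\log(t+\sqrt{t^2-1})$ for $t\ge1$. An isometry is a surjective distance-preserving map. *)

(* Defs.v *)
(* Stdlib reals. *)
From Stdlib Require Import Reals FinFun.
Local Open Scope R_scope.

(* Meaningful for t >= 1, outside which [sqrt] and [ln] take junk values. *)
Definition arcosh (t : R) : R := ln (t + sqrt (t ^ 2 - 1)).

(* The metric of H^1(R), whose underlying set is all of R. *)
Definition dist_h (x y : R) : R :=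
  arcosh (sqrt (1 + x ^ 2) * sqrt (1 + y ^ 2) - x * y).

Definition isometry {X Y : Type} (dX : X -> X -> R) (dY : Y -> Y -> R)
    (f : X -> Y) : Prop :=
  (forall x x' : X, dY (f x) (f x') = dX x x') /\ Surjective f.

(* Main.v *)
(** Since [sqrt (1 + sinh t ^ 2) = cosh t], the subtraction formula for [cosh]
    turns the argument of [arcosh] in [dist_h (sinh s) (sinh t)] into
    [cosh (s - t) = cosh |s - t|], which [arcosh] maps to [|s - t|]. *)
Require Import Defs.
From Stdlib Require Import Reals Lra.
Local Open Scope R_scope.

Lemma cosh_sqr (t : R) : cosh t ^ 2 = 1 + sinh t ^ 2.
Proof.
  pose proof (exp_pos t).
  unfold cosh, sinh; rewrite exp_Ropp; field; lra.
Qed.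

Lemma cosh_pos (t : R) : 0 < cosh t.
Proof.
  pose proof (exp_pos t); pose proof (exp_pos (- t)); unfold cosh; lra.
Qed.

Lemma cosh_plus_sinh (t : R) : cosh t + sinh t = exp t.
Proof. unfold cosh, sinh; field. Qed.

Lemma sinh_nonneg (t : R) : 0 <= t -> 0 <= sinh t.
Proof.
  (* Only the left-hand [0] becomes [sinh 0]; the case [t = 0] has a second zero, inside [sinh]. *)
  intros [Ht | <-]; rewrite <- sinh_0 at 1; [left; now apply sinh_lt | apply Rle_refl].
Qed.

Lemma cosh_minus (s t : R) : cosh (s - t) = cosh s * cosh t - sinh s * sinh t.
Proof.
  pose proof (exp_pos s); pose proof (exp_pos t).
  unfold cosh, sinh, Rminus.
  (* Both sides become rational functions of [exp s] and [exp t]. *)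
  rewrite !Ropp_plus_distr, !Ropp_involutive, !exp_plus, !exp_Ropp; field; lra.
Qed.

Lemma cosh_Rabs (t : R) : cosh (Rabs t) = cosh t.
Proof.
  unfold Rabs; destruct (Rcase_abs t); [| reflexivity].
  unfold cosh; rewrite Ropp_involutive; field.
Qed.

Lemma sqrt_1_plus_sinh_sqr (t : R) : sqrt (1 + sinh t ^ 2) = cosh t.
Proof.
  rewrite <- cosh_sqr; apply sqrt_pow2, Rlt_le, cosh_pos.
Qed.

(** The root in [arcosh] is that of [sinh t ^ 2]; for [0 <= t] it equals [sinh t] rather than its
    opposite, so the logarithm is taken of [cosh t + sinh t = exp t]. *)
Lemma arcosh_cosh (t : R) : 0 <= t -> arcosh (cosh t) = t.
Proof.
  intros Ht; unfold arcosh.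
  replace (cosh t ^ 2 - 1) with (sinh t ^ 2) by (rewrite cosh_sqr; ring).
  rewrite sqrt_pow2 by now apply sinh_nonneg.
  now rewrite cosh_plus_sinh, ln_exp.
Qed.

Theorem corollary4p2 : isometry Rdist dist_h sinh.
Proof.
  split.
  - intros s t; unfold dist_h, Rdist.
    rewrite !sqrt_1_plus_sinh_sqr, <- cosh_minus, <- cosh_Rabs.
    apply arcosh_cosh, Rabs_pos.
  - intros y; exists (arcsinh y); apply sinh_arcsinh.
Qed.
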